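(* Suppose that $G_n$ and $G_n'$, $n\ge 1$, are graphs with $v(G_n)\to\infty$, $v(G_n')\to\infty$, $G_n\to\Gamma\in\mathcal U_\infty$ and $G_n'\to\Gamma'\in\mathcal U_\infty$ as $n\to\infty$. If further $v(G_n)/\bigl(v(G_n)+v(G_n')\bigr)\to\alpha\in[0,1]$ as $n\to\infty$, then $G_n\oplus G_n'\to\alpha\Gamma\oplus(1-\alpha)\Gamma'$ as $n\to\infty$.
   Context: Graphs are finite, simple, undirected, with at least one vertex; $V(G)$, $E(G)$ are the vertex and edge sets, $v(G)=|V(G)|$, $e(G)=|E(G)|$. $G_1\oplus G_2$ for graphs denotes their disjoint union. Graph limits. For graphs $F,G$, $t(F,G)$ is the probability that a uniformly random map $V(F)\to V(G)$ is a graph homomorphism (maps edges to edges). The set $\mathcal U$ of unlabelled graphs (isomorphism classes) is embedded as a dense subset of a compact metric space $\overline{\mathcal U}$; the elements of $\mathcal U_\infty=\overline{\mathcal U}\setminus\mathcal U$ are called graph limits, and $v(\Gamma)=\infty$ for $\Gamma\in\mathcal U_\infty$. Each $t(F,\cdot)$ extends continuously to $\overline{\mathcal U}$; a graph limit $\Gamma$ is determined by the numbers $t(F,\Gamma)$, $F$ ranging over all graphs; and a sequence $G_n$ in $\overline{\mathcal U}$ converges to $\Gamma\in\mathcal U_\infty$ iff $v(G_n)\to\infty$ and $t(F,G_n)\to t(F,\Gamma)$ for every graph $F$. (Concretely, graph limits can be identified with the families $(t_F)_F$ arising as $t_F=\lim_n t(F,G_n)$ for sequences of graphs with $v(G_n)\to\infty$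 for which all these limits exist.) Direct sum of graph limits. For $\Gamma_1,\Gamma_2\in\mathcal U_\infty$ and $\alpha\in[0,1]$, $\alpha\Gamma_1\oplus(1-\alpha)\Gamma_2$ is the unique graph limit $\Gamma$ with $t(F,\Gamma)=\alpha^{v(F)}t(F,\Gamma_1)+(1-\alpha)^{v(F)}t(F,\Gamma_2)$ for every connected graph $F$. *)

(* Defs.v *)
From mathcomp Require Import all_boot all_order all_algebra.
From mathcomp Require Import all_classical all_reals all_analysis.
Import numFieldNormedType.Exports.
Import Order.TTheory GRing.Theory Num.Theory.

Set Implicit Arguments.
Unset Strict Implicit.
Unset Printing Implicit Defensive.

Local Open Scope classical_set_scope.
Local Open Scope ring_scope.

Record sgraph := SGraph {
  vertex :> finType;
  adj : rel vertex;
  adj_sym : symmetric adj;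
  adj_irrefl : irreflexive adj;
  vertex_gt0 : (0 < #|vertex|)%N }.

Definition nverts (G : sgraph) : nat := #|G|.

Definition connected_graph (G : sgraph) : Prop :=
  forall x y : G, connect (@adj G) x y.

Section DisjointUnion.
Variables G1 G2 : sgraph.

Definition gsum_adj : rel (G1 + G2)%type := fun x y =>
  match x, y with
  | inl x1, inl y1 => adj x1 y1
  | inr x2, inr y2 => adj x2 y2
  | _, _ => false
  end.

Lemma gsum_adj_sym : symmetric gsum_adj.
Proof. by move=> [x|x] [y|y] //=; rewrite adj_sym. Qed.

Lemma gsum_adj_irrefl : irreflexive gsum_adj.
Proof. by move=> [x|x] /=; rewrite adj_irrefl. Qed.

Lemma gsum_vertex_gt0 : (0 < #|{: G1 + G2}|)%N.
Proof. by rewrite card_sum addn_gt0 vertex_gt0. Qed.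

Definition gsum : sgraph :=
  SGraph gsum_adj_sym gsum_adj_irrefl gsum_vertex_gt0.

End DisjointUnion.

Definition is_hom (F G : sgraph) (f : {ffun F -> G}) : bool :=
  [forall x, forall y, adj x y ==> adj (f x) (f y)].

(* Probability that a uniformly random map V(F) -> V(G) is a homomorphism. *)
Definition hom_density (R : realType) (F G : sgraph) : R :=
  #|[set f : {ffun F -> G} | is_hom f]%SET|%:R / #|{ffun F -> G}|%:R.

Definition nverts_diverges (G : nat -> sgraph) : Prop :=
  nverts (G n) @[n --> \oo] --> \oo.

(* A graph limit is identified with the family of its densities t(F, _), so
   the graph limits are exactly the pointwise limits of the densities along
   sequences of graphs of diverging order. *)
Record graph_limit (R : realType) := GraphLimit {
  limit_density :> sgraph -> R;
  limit_densityP : exists G : nat -> sgraph, nverts_diverges G /\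
    forall F : sgraph,
      hom_density R F (G n) @[n --> \oo] --> limit_density F }.

Definition graphs_cvg (R : realType) (G : nat -> sgraph) (L : graph_limit R) :
    Prop :=
  nverts_diverges G /\
  forall F : sgraph, hom_density R F (G n) @[n --> \oo] --> L F.

Definition is_limit_sum (R : realType) (a : R) (L1 L2 L : graph_limit R) :
    Prop :=
  forall F : sgraph, connected_graph F ->
    L F = a ^+ nverts F * L1 F + (1 - a) ^+ nverts F * L2 F.

(* Definite description of a L1 (+) (1 - a) L2: the condition determines L,
   and the junk value L1 is only reached when no graph limit satisfies it,
   which does not happen for 0 <= a <= 1. *)
Definition limit_sum (R : realType) (a : R) (L1 L2 : graph_limit R) :
    graph_limit R :=
  match pselect (exists L, is_limit_sum a L1 L2 L) with
  | left ex => projT1 (cid ex)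
  | right _ => L1
  end.

(* Main.v *)
Require Import Defs.
From mathcomp Require Import all_boot all_order all_algebra.
From mathcomp Require Import all_classical all_reals all_analysis.
Import numFieldNormedType.Exports.
Import Order.TTheory GRing.Theory Num.Theory.

Local Open Scope classical_set_scope.
Local Open Scope ring_scope.

(** The sum of two graph limits is prescribed only on connected graphs, so two
    facts are needed: what t(F, _) does to a disjoint union when F is connected,
    and how a general F is reduced to connected ones.

    If F is connected, a homomorphism from F to G (+) G' stays on one side, so
    hom(F, G (+) G') = hom(F, G) + hom(F, G'); after normalising, with
    r = v(G) / (v(G) + v(G')) and k = v(F), this is
    t(F, G (+) G') = r^k t(F, G) + (1 - r)^k t(F, G') [hom_density_gsum].
    Letting n tend to infinity gives exactly the formula that defines
    a L (+) (1 - a) L'.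

    If no edge of F leaves the vertex set S, a homomorphism from F is a pair of
    homomorphisms from F[S] and F[~S] chosen independently, so
    t(F, _) = t(F[S], _) t(F[~S], _) [hom_density_split]. This identity passes
    to graph limits. By induction on the number of vertices [component_ind] it
    yields both that t(F, G_n (+) G_n') converges for every F, so that the
    disjoint unions converge to some graph limit, and that a graph limit is
    determined by its values on connected graphs [limit_density_inj]. The limit
    found and the limit sum agree on connected graphs, hence everywhere. *)

(** * Induced subgraphs and induction on components *)

Section Induced.
Variables (F : sgraph) (S : {set F}) (S0 : S != finset.set0).

Definition induced_adj : rel {x : F | x \in S} :=
  fun x y => adj (val x) (val y).

Lemma induced_adj_sym : symmetric induced_adj.
Proof. by move=> x y; apply: adj_sym. Qed.

Lemma induced_adj_irrefl : irreflexive induced_adj.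
Proof. by move=> x; apply: adj_irrefl. Qed.

Lemma induced_vertex_gt0 : (0 < #|{: {x : F | x \in S}}|)%N.
Proof. by rewrite card_sig card_gt0. Qed.

Definition induced : sgraph :=
  SGraph induced_adj_sym induced_adj_irrefl induced_vertex_gt0.

Lemma nverts_induced : nverts induced = #|S|.
Proof. by rewrite /nverts card_sig. Qed.

End Induced.
Arguments induced {F S}.

(** Cutting a disconnected graph along the component of a vertex leaves two
    nonempty parts, each with fewer vertices. *)
Lemma component_ind (P : sgraph -> Prop) :
  (forall F, connected_graph F -> P F) ->
  (forall (F : sgraph) (S : {set F})
      (S0 : S != finset.set0) (SC0 : ~: S != finset.set0),
    fingraph.closed (@adj F) (mem S) ->
    P (induced S0) -> P (induced SC0) -> P F) ->
  forall F, P F.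
Proof.
move=> Pconn Psplit F.
have [m] := ubnP (nverts F); elim: m F => // m IHm F ltFm.
have [/forallP cF|] := boolP [forall x : F, forall y, connect (@adj F) x y].
  by apply: Pconn => x y; have /forallP := cF x; apply.
rewrite negb_forall => /existsP[x]; rewrite negb_forall => /existsP[y nxy].
pose S := [set z | connect (@adj F) x z]%SET.
have S0 : S != finset.set0 by apply/set0Pn; exists x; rewrite inE connect0.
have SC0 : ~: S != finset.set0 by apply/set0Pn; exists y; rewrite !inE.
have cS : fingraph.closed (@adj F) (mem S).
  move=> u v uv; rewrite !inE; apply/idP/idP => xu.
    exact: connect_trans xu (connect1 uv).
  by apply: connect_trans xu (connect1 _); rewrite adj_sym.
have lt0 : (0 < #|S|)%N by rewrite card_gt0.
have lt1 : (0 < #|~: S|)%N by rewrite card_gt0.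
have card_F : (#|S| + #|~: S| = nverts F)%N by rewrite cardsC.
have lt_m : (#|S| + #|~: S| <= m)%N by rewrite card_F.
apply: (Psplit F S S0 SC0 cS); apply: IHm; rewrite nverts_induced.
  by apply: leq_trans lt_m; rewrite -addn1 leq_add2l.
by apply: leq_trans lt_m; rewrite -add1n leq_add2r.
Qed.

(** * Multiplicativity over a splitting of the vertices *)

Section Split.
Variables (F : sgraph) (S : {set F}).
Hypotheses (S0 : S != finset.set0) (SC0 : ~: S != finset.set0).
Variable G : sgraph.

Definition split_ffun (f : {ffun F -> G}) :
    {ffun induced S0 -> G} * {ffun induced SC0 -> G} :=
  ([ffun x => f (val x)], [ffun x => f (val x)]).

Lemma card_split_ffun :
  #|{ffun F -> G}| = (#|{ffun induced S0 -> G}| * #|{ffun induced SC0 -> G}|)%N.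
Proof.
by rewrite !card_ffun -expnD -!/(nverts (induced _)) !nverts_induced cardsC.
Qed.

Lemma split_ffun_bij : bijective split_ffun.
Proof.
apply: inj_card_bij; last by rewrite card_prod card_split_ffun.
move=> f g [/ffunP fgS /ffunP fgSC]; apply/ffunP => x.
have [xS|xS] := boolP (x \in S).
  by have := fgS (exist _ x xS); rewrite !ffunE.
rewrite -finset.in_setC in xS.
by have := fgSC (exist _ x xS); rewrite !ffunE.
Qed.

Hypothesis cS : fingraph.closed (@adj F) (mem S).

Lemma is_hom_split (f : {ffun F -> G}) :
  is_hom f = is_hom (split_ffun f).1 && is_hom (split_ffun f).2.
Proof.
apply/idP/andP => [/forallP hf|[/forallP hS /forallP hSC]].
  by split; apply/forallP => x; apply/forallP => y; rewrite !ffunE;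
     have /forallP := hf (val x); apply.
apply/forallP => x; apply/forallP => y; apply/implyP => xy.
have [xS|xS] := boolP (x \in S).
  have yS : y \in S by rewrite -(cS _ _ xy).
  have /forallP/(_ (exist _ y yS)) := hS (exist _ x xS).
  by rewrite !ffunE => /implyP; apply.
have yS : y \in ~: S by rewrite finset.in_setC -(cS _ _ xy).
rewrite -finset.in_setC in xS.
have /forallP/(_ (exist _ y yS)) := hSC (exist _ x xS).
by rewrite !ffunE => /implyP; apply.
Qed.

(** Restricting to S and to its complement is a bijection under which
    homomorphisms are the pairs of homomorphisms: every edge lies within one of
    the two parts. *)
Lemma hom_density_split (R : realType) :
  hom_density R F G =
  hom_density R (induced S0) G * hom_density R (induced SC0) G.
Proof.
rewrite /hom_density mulrACA -invfM -!natrM -card_split_ffun; congr (_%:R / _).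
rewrite -finset.cardsX -(on_card_preimset (onW_bij _ split_ffun_bij)).
by apply: eq_card => f; rewrite !inE is_hom_split.
Qed.

End Split.

(** * Connected graphs and disjoint unions *)

Section ConnectedGsum.
Variables (F : sgraph) (cF : connected_graph F) (G1 G2 : sgraph).

Definition in_left (f : {ffun F -> G1}) : {ffun F -> gsum G1 G2} :=
  [ffun x => inl (f x)].
Definition in_right (f : {ffun F -> G2}) : {ffun F -> gsum G1 G2} :=
  [ffun x => inr (f x)].

Lemma in_left_inj : injective in_left.
Proof.
by move=> f g /ffunP fg; apply/ffunP => x; have := fg x; rewrite !ffunE => -[].
Qed.

Lemma in_right_inj : injective in_right.
Proof.
by move=> f g /ffunP fg; apply/ffunP => x; have := fg x; rewrite !ffunE => -[].
Qed.

Lemma is_hom_in_left f : is_hom (in_left f) = is_hom f.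
Proof. by apply: eq_forallb => x; apply: eq_forallb => y; rewrite !ffunE. Qed.

Lemma is_hom_in_right f : is_hom (in_right f) = is_hom f.
Proof. by apply: eq_forallb => x; apply: eq_forallb => y; rewrite !ffunE. Qed.

(** Adjacent vertices have adjacent images, which lie in the same summand, so
    the side is constant on the connected graph F. *)
Lemma hom_one_side (f : {ffun F -> gsum G1 G2}) : is_hom f ->
  (exists g, f = in_left g) \/ (exists g, f = in_right g).
Proof.
move=> /forallP hf.
pose side (x : F) := if f x is inl _ then true else false.
have side_adj x y : adj x y -> side x = side y.
  move=> xy; have /forallP/(_ y)/implyP/(_ xy) := hf x.
  by rewrite /side; case: (f x) (f y) => [u|u] [v|v].
have side_cst x y : side x = side y.
  have /connectP[p pxp ->] := cF x y.
  by elim: p x pxp => //= z p IHp x /andP[/side_adj -> /IHp].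
have /card_gt0P[x0 _] := vertex_gt0 F.
case fx0: (f x0) => [u|u]; [left|right].
  exists [ffun x => if f x is inl v then v else u]; apply/ffunP => x.
  by rewrite !ffunE; have := side_cst x x0; rewrite /side fx0; case: (f x).
exists [ffun x => if f x is inr v then v else u]; apply/ffunP => x.
by rewrite !ffunE; have := side_cst x x0; rewrite /side fx0; case: (f x).
Qed.

Lemma card_hom_gsum :
  #|[set f : {ffun F -> gsum G1 G2} | is_hom f]%SET| =
  (#|[set f : {ffun F -> G1} | is_hom f]%SET| +
   #|[set f : {ffun F -> G2} | is_hom f]%SET|)%N.
Proof.
rewrite -(card_imset _ in_left_inj) -(card_imset _ in_right_inj) -cardsUI.
set A := in_left @: _; set B := in_right @: _.
have -> : A :&: B = finset.set0.
  apply/setP => h; rewrite !inE; apply/negP => /andP[/imsetP[f _ ->]].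
  have /card_gt0P[x0 _] := vertex_gt0 F.
  by move=> /imsetP[g _ /ffunP/(_ x0)]; rewrite !ffunE.
rewrite cards0 addn0; apply: eq_card => h; rewrite !inE.
apply/idP/orP => [hh|[] /imsetP[f + ->]].
- case: (hom_one_side _ hh) => -[f hf]; [left|right]; apply/imsetP;
    exists f; rewrite // inE.
    by rewrite -is_hom_in_left -hf.
  by rewrite -is_hom_in_right -hf.
- by rewrite inE is_hom_in_left.
- by rewrite inE is_hom_in_right.
Qed.

Lemma hom_density_gsum (R : realType)
    (r : R := (nverts G1)%:R / (nverts G1 + nverts G2)%N%:R) :
  hom_density R F (gsum G1 G2) =
  r ^+ nverts F * hom_density R F G1 + (1 - r) ^+ nverts F * hom_density R F G2.
Proof.
have v1 : (nverts G1)%:R != 0 :> R by rewrite pnatr_eq0 -lt0n vertex_gt0.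
have v2 : (nverts G2)%:R != 0 :> R by rewrite pnatr_eq0 -lt0n vertex_gt0.
have v12 : (nverts G1 + nverts G2)%N%:R != 0 :> R.
  by rewrite pnatr_eq0 -lt0n addn_gt0 vertex_gt0.
have -> : 1 - r = (nverts G2)%:R / (nverts G1 + nverts G2)%N%:R.
  by apply: (mulIf v12); rewrite mulrBl !divfK// mul1r natrD addrAC subrr add0r.
rewrite /hom_density card_hom_gsum !card_ffun card_sum.
rewrite -!/(nverts _) !natrX !expr_div_n natrD mulrDl.
by congr (_ + _); rewrite [RHS]mulrC mulrA divfK// expf_neq0.
Qed.

End ConnectedGsum.

(** * Graph limits *)

(** A graph limit inherits multiplicativity from the graphs converging to it. *)
Lemma limit_density_split (R : realType) (L : graph_limit R) (F : sgraph)
    (S : {set F}) (S0 : S != finset.set0) (SC0 : ~: S != finset.set0) :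
  fingraph.closed (@adj F) (mem S) ->
  L F = L (induced S0) * L (induced SC0).
Proof.
move=> cS; have [G [_ GL]] := limit_densityP L.
apply: (cvg_unique _ (GL F)) => //.
rewrite (funext (fun n => hom_density_split F S S0 SC0 (G n) cS R)).
by apply: cvgM; apply: GL.
Qed.

(** Cutting off components one at a time writes every density as a product of
    densities of connected graphs. *)
Lemma limit_density_inj (R : realType) (L1 L2 : graph_limit R) :
  (forall F, connected_graph F -> L1 F = L2 F) -> forall F, L1 F = L2 F.
Proof.
move=> L12; apply: component_ind => // F S S0 SC0 cS IH IHC.
by rewrite !(limit_density_split _ _ _ S S0 SC0 cS) IH IHC.
Qed.

(** The choice made by limit_sum is immaterial: any witness of the defining
    formula has the same densities. *)
Lemma limit_sum_unique (R : realType) (a : R) (L1 L2 L : graph_limit R) :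
  is_limit_sum a L1 L2 L -> forall F, limit_sum a L1 L2 F = L F.
Proof.
move=> sumL; rewrite /limit_sum; case: pselect => [ex|[]]; last by exists L.
apply: limit_density_inj => F cF.
by rewrite (projT2 (cid ex) F cF) (sumL F cF).
Qed.

Lemma nverts_diverges_gsum (G G' : nat -> sgraph) :
  nverts_diverges G -> nverts_diverges (fun n => gsum (G n) (G' n)).
Proof.
move=> /cvgnyPge hG; apply/cvgnyPge => A; apply: filterS (hG A) => n AGn.
by rewrite /nverts card_sum; apply: leq_trans AGn (leq_addr _ _).
Qed.

(** * Convergence of disjoint unions *)

Section GsumCvg.
Variables (R : realType) (G G' : nat -> sgraph) (L L' : graph_limit R) (a : R).
Hypotheses (GL : graphs_cvg G L) (GL' : graphs_cvg G' L').
Hypothesis ratio : (nverts (G n))%:R / (nverts (G n) + nverts (G' n))%N%:R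
  @[n --> \oo] --> a.

Lemma hom_density_gsum_cvg_connected (F : sgraph) : connected_graph F ->
  hom_density R F (gsum (G n) (G' n)) @[n --> \oo] -->
    a ^+ nverts F * L F + (1 - a) ^+ nverts F * L' F.
Proof.
move=> cF; rewrite (funext (fun n => hom_density_gsum F cF (G n) (G' n) R)).
have cvgX (u : nat -> R) (l : R) k :
    u n @[n --> \oo] --> l -> u n ^+ k @[n --> \oo] --> l ^+ k.
  by move=> ul; apply: cvg_comp ul (@exprn_continuous R k l).
apply: cvgD; apply: cvgM; [exact: cvgX|exact: (GL.2 F)| |exact: (GL'.2 F)].
by apply: cvgX; apply: cvgB => //; apply: cvg_cst.
Qed.

Lemma hom_density_gsum_is_cvg (F : sgraph) :
  cvg (hom_density R F (gsum (G n) (G' n)) @[n --> \oo]).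
Proof.
elim/component_ind: F => [F cF|F S S0 SC0 cS IH IHC].
  by apply/cvg_ex; eexists; apply: hom_density_gsum_cvg_connected.
rewrite (funext (fun n => hom_density_split F S S0 SC0 _ cS R)).
exact: is_cvgM.
Qed.

(** The pointwise limits form a graph limit because the disjoint unions
    themselves are the graphs of diverging order that realise them. *)
Lemma gsum_graphs_cvg :
  exists2 M : graph_limit R, graphs_cvg (fun n => gsum (G n) (G' n)) M &
    is_limit_sum a L L' M.
Proof.
pose m F := lim (hom_density R F (gsum (G n) (G' n)) @[n --> \oo]).
have div := nverts_diverges_gsum G G' GL.1.
have cvgm F : hom_density R F (gsum (G n) (G' n)) @[n --> \oo] --> m F.
  exact: hom_density_gsum_is_cvg.
exists (GraphLimit (ex_intro _ _ (conj div cvgm))); first by split.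
move=> F cF /=; apply: (cvg_unique _ (cvgm F)) => //.
exact: hom_density_gsum_cvg_connected.
Qed.

End GsumCvg.

Theorem theorem1p1 (R : realType) (G G' : nat -> sgraph)
    (L L' : graph_limit R) (a : R)
    (hG : nverts_diverges G) (hG' : nverts_diverges G')
    (hGL : graphs_cvg G L) (hGL' : graphs_cvg G' L')
    (ha0 : 0 <= a) (ha1 : a <= 1)
    (hratio : (nverts (G n))%:R / (nverts (G n) + nverts (G' n))%N%:R
                @[n --> \oo] --> a) :
  graphs_cvg (fun n => gsum (G n) (G' n)) (limit_sum a L L').
Proof.
have [M [div cvgM] sumM] := gsum_graphs_cvg R G G' L L' a hGL hGL' hratio.
by split=> // F; rewrite (limit_sum_unique _ _ _ _ _ sumM).
Qed.
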